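(* For all programs $C\in\mathsf{pWhile}$, post-expectations $f\in\mathbb{E}_{meas}$, $g\in\mathbb{E}^{\le1}_{meas}$, and integers $N\ge1$, $$\underline{\mathsf{wp}}^N[C](f)\sqsubseteq\mathsf{wp}[C](f)\sqsubseteq\overline{\mathsf{wp}}^N[C](f)\quad\text{and}\quad\underline{\mathsf{wlp}}^N[C](g)\sqsubseteq\mathsf{wlp}[C](g)\sqsubseteq\overline{\mathsf{wlp}}^N[C](g).$$
   Context: Programs. Let $V$ be a finite set of program variables and $S=\mathbb{R}_{\ge 0}^V$ the set of states (functions $V\to\mathbb{R}_{\ge 0}$) with its Borel $\sigma$-algebra; $\sigma[x\mapsto\xi]$ is the state mapping $x$ to $\xi$ and agreeing with $\sigma$ elsewhere. Arithmetic expressions are measurable functions $E:S\to\mathbb{R}_{\ge 0}$; guards are measurable functions $\varphi:S\to\{\mathrm{true},\mathrm{false}\}$; $[\varphi]$ is the indicator function of $\varphi$. Programs in $\mathsf{pWhile}$ are generated by $C ::= \mathtt{skip} \mid \mathtt{diverge} \mid x:=E \mid \mathtt{observe}(\varphi) \mid x:\approx\mathtt{unif}_{[0,1]} \mid \mathtt{if}(\varphi)\{C\}\,\mathtt{else}\,\{C\} \mid \{C\}[p]\{C\} \mid C;C \mid \mathtt{while}(\varphi)\{C\}$, with $x\in V$, $E$ an arithmetic expression, $\varphi$ a guard, $p\in[0,1]\cap\mathbb{Q}$. Expectations. $\mathbb{E}$: all functions $S\to[0,\infty]$; $\mathbb{E}^{\le 1}$: all functions $S\to[0,1]$; $\mathbb{E}_{meas}$,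 $\mathbb{E}^{\le 1}_{meas}$: the Borel measurable ones. $\sqsubseteq$ is the pointwise order; $+,\cdot$, sup, inf are pointwise, $0\cdot\infty=0$; $f[x/E]=\big(\sigma\mapsto f(\sigma[x\mapsto E(\sigma)])\big)$. Exact transformers. $\mathsf{wp}[C]:\mathbb{E}_{meas}\to\mathbb{E}_{meas}$: $\mathsf{wp}[\mathtt{skip}](f)=f$; $\mathsf{wp}[\mathtt{diverge}](f)=0$; $\mathsf{wp}[x:=E](f)=f[x/E]$; $\mathsf{wp}[x:\approx\mathtt{unif}_{[0,1]}](f)(\sigma)=\int_{[0,1]}f(\sigma[x\mapsto\xi])\,d\lambda(\xi)$ (Lebesgue integral); $\mathsf{wp}[\mathtt{observe}(\varphi)](f)=[\varphi]\cdot f$; $\mathsf{wp}[\mathtt{if}(\varphi)\{C_1\}\mathtt{else}\{C_2\}](f)=[\varphi]\cdot\mathsf{wp}[C_1](f)+[\neg\varphi]\cdot\mathsf{wp}[C_2](f)$; $\mathsf{wp}[\{C_1\}[p]\{C_2\}](f)=p\cdot\mathsf{wp}[C_1](f)+(1-p)\cdot\mathsf{wp}[C_2](f)$; $\mathsf{wp}[C_1;C_2](f)=\mathsf{wp}[C_1](\mathsf{wp}[C_2](f))$; $\mathsf{wp}[\mathtt{while}(\varphi)\{B\}](f)$ is the least fixed point of $Y\mapsto[\neg\varphi]\cdot f+[\varphi]\cdot\mathsf{wp}[B](Y)$. $\mathsf{wlp}[C]:\mathbb{E}^{\le 1}_{meas}\to\mathbb{E}^{\le 1}_{meas}$: same rules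 except $\mathsf{wlp}[\mathtt{diverge}](f)=1$ and greatest instead of least fixed points for loops. Riemann transformers. For an integer $N\ge1$, $\underline{\mathsf{wp}}^N[C],\overline{\mathsf{wp}}^N[C]:\mathbb{E}\to\mathbb{E}$ follow the rules of $\mathsf{wp}$ (on all of $\mathbb{E}$, fixed points in the complete lattice $\mathbb{E}$) and $\underline{\mathsf{wlp}}^N[C],\overline{\mathsf{wlp}}^N[C]:\mathbb{E}^{\le1}\to\mathbb{E}^{\le1}$ follow the rules of $\mathsf{wlp}$ (on all of $\mathbb{E}^{\le1}$), except that for $x:\approx\mathtt{unif}_{[0,1]}$ the lower versions map $f$ to $\frac1N\sum_{i=0}^{N-1}\inf_{\xi\in[i/N,(i+1)/N]}f[x/\xi]$ and the upper versions map $f$ to $\frac1N\sum_{i=0}^{N-1}\sup_{\xi\in[i/N,(i+1)/N]}f[x/\xi]$. *)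

(* Defs.v *)
From HB Require Import structures.
From mathcomp Require Import all_boot all_order all_algebra.
From mathcomp Require Import all_classical all_reals all_analysis.
From mathcomp Require Import measurable_realfun.

Set Implicit Arguments.
Unset Strict Implicit.
Unset Printing Implicit Defensive.

Import Order.TTheory GRing.Theory Num.Theory.
Import numFieldNormedType.Exports.

Local Open Scope classical_set_scope.
Local Open Scope ring_scope.

(* R_{>= 0} with the topology induced by R and its Borel sigma-algebra *)
Definition Rnneg (R : realType) : Type := {nonneg R}.

HB.instance Definition _ (R : realType) := Choice.copy (Rnneg R) {nonneg R}.
HB.instance Definition _ (R : realType) :=
  isPointed.Build (Rnneg R) (0%:nng : {nonneg R}).
HB.instance Definition _ (R : realType) :=
  Topological.copy (Rnneg R)
    (initial_topology (fun r : Rnneg R => r%:num : R)).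
HB.instance Definition _ (R : realType) :=
  Measurable.copy (Rnneg R) (g_sigma_algebraType (@open (Rnneg R))).

(* states V -> R_{>= 0} with the product topology and its Borel
   sigma-algebra *)
Definition state (V : finType) (R : realType) : Type := V -> Rnneg R.

HB.instance Definition _ (V : finType) (R : realType) :=
  Choice.copy (state V R) (prod_topology (fun _ : V => Rnneg R)).
HB.instance Definition _ (V : finType) (R : realType) :=
  isPointed.Build (state V R) (fun=> point).
HB.instance Definition _ (V : finType) (R : realType) :=
  Topological.copy (state V R) (prod_topology (fun _ : V => Rnneg R)).
HB.instance Definition _ (V : finType) (R : realType) :=
  Measurable.copy (state V R) (g_sigma_algebraType (@open (state V R))).

Definition upd (V : finType) (R : realType)
    (s : state V R) (x : V) (r : Rnneg R) : state V R :=
  fun y => if y == x then r else s y.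

Inductive pWhile (V : finType) (R : realType) : Type :=
| Skip
| Diverge
| Assign (x : V) (E : {mfun state V R >-> Rnneg R})
| Observe (phi : {mfun state V R >-> bool})
| Unif (x : V)
| Ite (phi : {mfun state V R >-> bool}) (C1 C2 : pWhile V R)
| PChoice (C1 : pWhile V R) (p : rat) (hp : 0 <= p <= 1) (C2 : pWhile V R)
| Seq (C1 C2 : pWhile V R)
| While (phi : {mfun state V R >-> bool}) (B : pWhile V R).

(* Expectations are carried by all functions to the extended reals; the
   predicates below cut out those with values in [0, +oo] or [0, 1]. *)
Definition Expectation (V : finType) (R : realType) : Type :=
  state V R -> \bar R.

Section Expectations.
Context {V : finType} {R : realType}.
Implicit Types (f g Y Z : Expectation V R) (D : set (Expectation V R)).
Local Open Scope ereal_scope.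

Definition ele f g : Prop := forall s, f s <= g s.

Definition EE : set (Expectation V R) := [set f | forall s, 0 <= f s].

Definition EE1 : set (Expectation V R) := [set f | forall s, 0 <= f s <= 1].

Definition EE_meas : set (Expectation V R) :=
  EE `&` [set f | measurable_fun [set: state V R] f].

Definition EE1_meas : set (Expectation V R) :=
  EE1 `&` [set f | measurable_fun [set: state V R] f].

Definition is_lfp D (Phi : Expectation V R -> Expectation V R) Y : Prop :=
  [/\ D Y, Phi Y = Y & forall Z, D Z -> Phi Z = Z -> ele Y Z].

Definition is_gfp D (Phi : Expectation V R -> Expectation V R) Y : Prop :=
  [/\ D Y, Phi Y = Y & forall Z, D Z -> Phi Z = Z -> ele Z Y].

(* the least (greatest) fixed point of Phi in D, unique when it exists; the
   first argument of xget is only returned when there is none *)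
Definition lfp D (Phi : Expectation V R -> Expectation V R) :
    Expectation V R :=
  xget (cst 0) [set Y | is_lfp D Phi Y].

Definition gfp D (Phi : Expectation V R -> Expectation V R) :
    Expectation V R :=
  xget (cst 0) [set Y | is_gfp D Phi Y].

Definition iverson (b : bool) : \bar R := (b%:R)%:E.

End Expectations.

Notation "f ⊑ g" := (ele f g) (at level 70, no associativity).

(* The rules common to all the transformers, which differ in the rule for
   uniform sampling, the value on diverge, and the fixed point operator. *)
Fixpoint transformer (V : finType) (R : realType)
    (unif : V -> Expectation V R -> Expectation V R)
    (div : Expectation V R)
    (fp : (Expectation V R -> Expectation V R) -> Expectation V R)
    (C : pWhile V R) (f : Expectation V R) {struct C} : Expectation V R :=
  let T := transformer unif div fp in
  match C with
  | Skip => f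
  | Diverge => div
  | Assign x E => fun s => f (upd s x (E s))
  | Observe phi => fun s => (iverson (phi s) * f s)%E
  | Unif x => unif x f
  | Ite phi C1 C2 => fun s =>
      (iverson (phi s) * T C1 f s + iverson (~~ phi s) * T C2 f s)%E
  | PChoice C1 p _ C2 => fun s =>
      ((ratr p : R)%:E * T C1 f s + (1 - ratr p : R)%:E * T C2 f s)%E
  | Seq C1 C2 => T C1 (T C2 f)
  | While phi B =>
      fp (fun Y s => iverson (~~ phi s) * f s + iverson (phi s) * T B Y s)%E
  end.

Section Transformers.
Context {V : finType} {R : realType}.
Implicit Types (f : Expectation V R) (x : V).
Local Open Scope ereal_scope.

(* [upd_real s x xi] is s[x |-> xi]; it is only used for xi >= 0, where
   `|xi| = xi, the absolute value providing the membership in R_{>= 0}. *)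
Definition upd_real (s : state V R) x (xi : R) : state V R :=
  upd s x (`|xi|%:nng : {nonneg R})%R.

Definition unif_leb x f : Expectation V R := fun s =>
  \int[lebesgue_measure]_(xi in `[0%R, 1%R]) f (upd_real s x xi).

Definition subitv (N i : nat) : set R :=
  `[(i%:R / N%:R)%R, (i.+1%:R / N%:R)%R]%classic.

Definition unif_lower (N : nat) x f : Expectation V R := fun s =>
  (N%:R^-1 : R)%:E *
  \sum_(i < N) ereal_inf [set f (upd_real s x xi) | xi in subitv N i].

Definition unif_upper (N : nat) x f : Expectation V R := fun s =>
  (N%:R^-1 : R)%:E *
  \sum_(i < N) ereal_sup [set f (upd_real s x xi) | xi in subitv N i].

Definition wp : pWhile V R -> Expectation V R -> Expectation V R :=
  transformer unif_leb (cst 0) (lfp EE_meas).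

Definition wlp : pWhile V R -> Expectation V R -> Expectation V R :=
  transformer unif_leb (cst 1) (gfp EE1_meas).

Definition lower_wp (N : nat) :
    pWhile V R -> Expectation V R -> Expectation V R :=
  transformer (unif_lower N) (cst 0) (lfp EE).

Definition upper_wp (N : nat) :
    pWhile V R -> Expectation V R -> Expectation V R :=
  transformer (unif_upper N) (cst 0) (lfp EE).

Definition lower_wlp (N : nat) :
    pWhile V R -> Expectation V R -> Expectation V R :=
  transformer (unif_lower N) (cst 1) (gfp EE1).

Definition upper_wlp (N : nat) :
    pWhile V R -> Expectation V R -> Expectation V R :=
  transformer (unif_upper N) (cst 1) (gfp EE1).

End Transformers.

(* Main.v *)
(* Both pairs of inequalities are proved simultaneously by reversing the order:
   a boolean selects either [0, +oo] with <= and least fixed points (wp) or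
   [0, 1] with >= and greatest fixed points (wlp). The exact transformers
   preserve pointwise limits of monotone sequences (monotone or dominated
   convergence for sampling), so that loops are limits of Kleene iterates inside
   the measurable expectations. The Riemann transformers are only monotone, and
   their loops are governed by Knaster-Tarski. On the side where the Riemann
   fixed point must lie below (in the selected order), the exact fixed point is
   a prefixed point of the Riemann functional; on the other side every Kleene
   iterate lies below the Riemann fixed point. *)

Require Import Defs.
From mathcomp Require Import all_boot all_order all_algebra.
From mathcomp Require Import all_classical all_reals all_analysis.
From mathcomp Require Import measurable_realfun.

Set Implicit Arguments.
Unset Strict Implicit.
Unset Printing Implicit Defensive.

Import Order.TTheory GRing.Theory Num.Theory.
Import numFieldNormedType.Exports.

Local Open Scope classical_set_scope.
Local Open Scope ring_scope.

(** * Measurability of maps into the state space *)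

Section StateMeasurability.
Context {V : finType} {R : realType}.
Implicit Types (s t : state V R) (v : V).

Lemma continuous_num : continuous (fun r : Rnneg R => r%:num : R).
Proof. exact: initial_continuous. Qed.

Lemma continuous_coord v : continuous (fun s : state V R => s v).
Proof. exact: (@proj_continuous V (fun=> Rnneg R) v). Qed.

Lemma measurable_num :
  measurable_fun [set: Rnneg R] (fun r : Rnneg R => r%:num : R).
Proof.
apply: (measurability _ (RGenOpens.measurableE R)).
move=> _ [_ [a [b ->] <-]]; rewrite setTI; apply: sub_sigma_algebra.
have /continuousP := continuous_num; apply; exact: interval_open.
Qed.

Lemma measurable_coord v :
  measurable_fun [set: state V R] (fun s => (s v)%:num : R).
Proof.
apply: (measurability _ (RGenOpens.measurableE R)).
move=> _ [_ [a [b ->] <-]]; rewrite setTI; apply: sub_sigma_algebra.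
have cf : continuous (fun s : state V R => (s v)%:num : R).
  move=> s; apply: (@continuous_comp _ _ _ (fun s : state V R => s v)
    (fun r : Rnneg R => r%:num : R)).
    exact: continuous_coord.
  exact: continuous_num.
by have /continuousP := cf; apply; exact: interval_open.
Qed.

(** The corners form a finite function with rational entries, so that the boxes are indexed by a
    countable type. *)
Definition rat_box (a : {ffun V -> rat * rat}) : set (state V R) :=
  [set s : state V R | forall v,
    (ratr (a v).1 : R) < (s v)%:num < ratr (a v).2].

(** The supersets of the uniform balls [B e] form a filter, and convergence of a filter in the
    product topology can be tested coordinate by coordinate. This avoids handling finite
    intersections of cylinders. *)
Lemma nbhs_state s (U : set (state V R)) : nbhs s U ->
  exists2 e : R, 0 < e &
    forall t, (forall v, `|(t v)%:num - (s v)%:num| < e) -> U t.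
Proof.
pose B e := [set t : state V R | forall v, `|(t v)%:num - (s v)%:num| < e].
pose F := filter_from [set e : R | 0 < e] B.
have FF : Filter F.
  apply: filter_from_filter; first by exists 1; exact: ltr01.
  move=> e1 e2 /= e10 e20; exists (Num.min e1 e2) => /=.
    by rewrite lt_min e10.
  by move=> t /= tB; split => v; have := tB v; rewrite lt_min => /andP[].
suff: F --> s by move=> Fs /Fs [e e0 eU]; exists e.
apply/cvg_sup => v A /= [_ [[W Wop <-] Ws] WA].
have := Wop; case: Wop => W' oW' W'E _.
subst W.
have : nbhs ((s v)%:num : R) W'.
  by apply: open_nbhs_nbhs; split.
move=> /nbhs_ballP [e /= e0 eW]; exists e => //= t tB.
apply: WA => /=; apply: eW; rewrite /ball /= distrC; exact: tB.
Qed.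

Lemma open_rat_box s (U : set (state V R)) : open U -> U s ->
  exists2 a, rat_box a s & rat_box a `<=` U.
Proof.
rewrite openE => oU /oU /nbhs_state[e e0 eU].
have /choice [a aP] : forall v, exists q : rat * rat,
    [/\ (s v)%:num - e < ratr q.1 :> R, ratr q.1 < (s v)%:num :> R,
      (s v)%:num < ratr q.2 :> R & ratr q.2 < (s v)%:num + e :> R].
  move=> v.
  have lt_l : (s v)%:num - e < (s v)%:num by rewrite ltrBlDr ltrDl.
  have lt_r : (s v)%:num < (s v)%:num + e by rewrite ltrDl.
  have [q] := rat_in_itvoo lt_l; have [r] := rat_in_itvoo lt_r.
  by rewrite !in_itv /= => /andP[? ?] /andP[? ?]; exists (q, r).
exists (finfun a) => [v|t tB]; first by rewrite ffunE; have [_ -> ->] := aP v.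
apply: eU => v; have [h1 h2 h3 h4] := aP v.
have := tB v; rewrite ffunE => /andP[h5 h6].
by rewrite ltr_distl (lt_trans h1 h5) (lt_trans h6 h4).
Qed.

(** Coordinates suffice for Borel measurability: an open set is a countable union of rational boxes,
    and the preimage of a box is a finite intersection of coordinate preimages. *)
Lemma measurable_state d (T : measurableType d) (h : T -> state V R) :
  (forall v, measurable_fun [set: T] (fun x => (h x v)%:num : R)) ->
  measurable_fun [set: T] h.
Proof.
move=> mh.
apply: (measurability _
  (erefl : @measurable _ (state V R) = <<s @open (state V R) >>)).
move=> _ [U oU <-].
(* Boxes not contained in [U] contribute the empty set, so that the union runs over the whole
   countable type. *)
have -> : h @^-1` U = \bigcup_(a : {ffun V -> rat * rat})
    (if `[< rat_box a `<=` U >] then h @^-1` rat_box a else set0).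
  rewrite predeqE => x; split => [Ux|[a _]]; last first.
    by case: asboolP => // aU; exact: aU.
  by have [a ax aU] := open_rat_box oU Ux; exists a => //; rewrite asboolT.
rewrite setTI; apply: countable_bigcupT_measurable; first exact: countableP.
move=> a; case: asboolP => // _.
have -> : h @^-1` rat_box a = \bigcap_(v in [set: V])
   (fun x => (h x v)%:num : R) @^-1` `]ratr (a v).1, ratr (a v).2[.
  rewrite predeqE => x; split => [ax v _|ax v]; have := ax v.
    by rewrite /= in_itv.
  by move=> /(_ I); rewrite /= in_itv.
apply: fin_bigcap_measurable => // v _.
by rewrite -[X in measurable X]setTI; apply: mh.
Qed.

Lemma measurable_upd d (T : measurableType d) (h : T -> state V R) x
    (r : T -> Rnneg R) :
  measurable_fun [set: T] h ->
  measurable_fun [set: T] (fun y => (r y)%:num : R) ->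
  measurable_fun [set: T] (fun y => upd (h y) x (r y)).
Proof.
move=> mh mr; apply: measurable_state => v; rewrite /upd.
case: (v == x) => //.
exact: (measurableT_comp (measurable_coord v) mh).
Qed.

(** Joint measurability in state and sample, as Tonelli's theorem requires. *)
Lemma measurable_upd_real x :
  measurable_fun [set: (state V R * R)%type]
    (fun sr => upd_real sr.1 x sr.2).
Proof.
apply: measurable_upd; first exact: measurable_fst.
exact: (measurableT_comp (@normr_measurable R setT) measurable_snd).
Qed.

Lemma measurable_upd_realr s x :
  measurable_fun [set: R] (fun r => upd_real s x r).
Proof.
apply: measurable_upd; first exact: measurable_cst.
exact: normr_measurable.
Qed.

End StateMeasurability.

(** * Order and limits in the selected direction *)

Section DirectedOrder.
Context {R : realType}.
Implicit Types (b : bool) (x y z : \bar R) (u v : nat -> \bar R).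
Local Open Scope ereal_scope.

(* [b = true] is the setting of wp (ordinary order, domain [0, +oo], least
   fixed points), [b = false] that of wlp (reversed order, domain [0, 1],
   greatest fixed points). *)
Definition dle b x y : bool := if b then x <= y else y <= x.

Definition dlim b u := if b then ereal_sup (range u) else ereal_inf (range u).

(** The upper end of the domain in the ordinary order for both values of [b], whereas [dbot] is the
    least element of the selected order; for [b = false] both are 1. *)
Definition dub b : \bar R := if b then +oo else 1.

Definition dbot b : \bar R := if b then 0 else 1.

Definition in_dom b x : bool := 0 <= x <= dub b.

Lemma dle_refl b x : dle b x x.
Proof. by case: b => /=. Qed.

Lemma dle_trans b y x z : dle b x y -> dle b y z -> dle b x z.
Proof.
by case: b => /= xy yz; [exact: le_trans xy yz|exact: le_trans yz xy].
Qed.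

Lemma dle_anti b x y : dle b x y -> dle b y x -> x = y.
Proof. by case: b => /= xy yx; apply/eqP; rewrite eq_le xy yx. Qed.

Lemma dle_homo b u : (forall n, dle b (u n) (u n.+1)) ->
  forall n m, (n <= m)%N -> dle b (u n) (u m).
Proof.
move=> uS n m /subnK <-; elim: (m - n)%N => [|k IH]; first exact: dle_refl.
exact: dle_trans IH (uS _).
Qed.

Lemma dlim_ub b u n : dle b (u n) (dlim b u).
Proof.
by case: b => /=; [apply: ereal_sup_ubound|apply: ereal_inf_lbound]; exists n.
Qed.

Lemma dlim_lub b u x : (forall n, dle b (u n) x) -> dle b (dlim b u) x.
Proof.
case: b => /= ux; first by apply: ge_ereal_sup => _ [n _ <-].
by apply: le_ereal_inf_tmp => _ [n _ <-].
Qed.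

Lemma dlim_cvg b u : (forall n, dle b (u n) (u n.+1)) -> u @ \oo --> dlim b u.
Proof.
move=> /dle_homo; case: b => /= uS.
  by apply: ereal_nondecreasing_cvgn => n m; exact: uS.
by apply: ereal_nonincreasing_cvgn => n m; exact: uS.
Qed.

(** The bridge from topology to order: convergence theorems produce topological limits, which are
    identified here with suprema in the selected order. *)
Lemma cvg_dlim b u x : (forall n, dle b (u n) (u n.+1)) ->
  u @ \oo --> x -> dlim b u = x.
Proof.
by move=> uS ux; apply: cvg_unique ux; [exact: ereal_hausdorff|exact: dlim_cvg].
Qed.

Lemma dlim_cst b x : dlim b (fun=> x) = x.
Proof. by apply: cvg_dlim => [n|]; [exact: dle_refl|exact: cvg_cst]. Qed.

Lemma dlim_le b u v : (forall n, dle b (u n) (v n)) ->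
  dle b (dlim b u) (dlim b v).
Proof.
by move=> uv; apply: dlim_lub => n; apply: dle_trans (dlim_ub b v n).
Qed.

Lemma dlim_shift b u : (forall n, dle b (u n) (u n.+1)) ->
  dlim b (fun n => u n.+1) = dlim b u.
Proof.
move=> uS; apply: (@dle_anti b); last by apply: dlim_le => n; exact: uS.
by apply: dlim_lub => n; exact: dlim_ub.
Qed.

(** Both sides are the supremum, in the selected order, of the whole double family. *)
Lemma dlim_exchange b (a : nat -> nat -> \bar R) :
  dlim b (fun n => dlim b (a n)) = dlim b (fun m => dlim b (a^~ m)).
Proof.
apply: (@dle_anti b); do 2 (apply: dlim_lub => ?).
  by apply: dle_trans (dlim_ub b _ _); exact: (dlim_ub b (a^~ _)).
apply: dle_trans (dlim_ub b _ _); exact: (dlim_ub b (a _)).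
Qed.

Lemma in_dom_dlim b u : (forall n, in_dom b (u n)) -> in_dom b (dlim b u).
Proof.
rewrite /in_dom /dub => uD; apply/andP; split; case: b uD => /= uD.
- by apply: le_trans (@dlim_ub true u 0%N); case/andP: (uD 0%N).
- by apply: (@dlim_lub false) => n /=; case/andP: (uD n).
- exact: leey.
- by apply: le_trans (@dlim_ub false u 0%N) _; case/andP: (uD 0%N).
Qed.

Lemma in_dom_dbot b : in_dom b (dbot b).
Proof. by case: b; rewrite /in_dom /= ?lexx ?lee01 ?leey. Qed.

Lemma dbot_le b x : in_dom b x -> dle b (dbot b) x.
Proof. by case: b => /andP[]. Qed.

End DirectedOrder.

(** * Fixed points in the selected order *)

Section FixedPoints.
Context {V : finType} {R : realType}.
Implicit Types (b : bool) (f g Y Z : Expectation V R) (x : V) (s : state V R).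
Local Open Scope ereal_scope.

Definition dom b : set (Expectation V R) := if b then EE else EE1.

Definition dom_meas b : set (Expectation V R) :=
  if b then EE_meas else EE1_meas.

Definition dele b f g : Prop := forall s, dle b (f s) (g s).

Definition delim b (u : nat -> Expectation V R) : Expectation V R :=
  fun s => dlim b (u^~ s).

(** Unfolds to [is_lfp] for [b = true] and to [is_gfp] for [b = false], so that results on [fix_of]
    transfer to [lfp] and [gfp] by conversion. *)
Definition is_fix b D (Phi : Expectation V R -> Expectation V R) Y : Prop :=
  [/\ D Y, Phi Y = Y & forall Z, D Z -> Phi Z = Z -> dele b Y Z].

Definition fix_of b D (Phi : Expectation V R -> Expectation V R) :
    Expectation V R :=
  xget (cst 0) [set Y | is_fix b D Phi Y].

Lemma domP b f : dom b f <-> forall s, in_dom b (f s).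
Proof.
case: b; split => fD s; have := fD s; rewrite /in_dom /= ?leey ?andbT //.
Qed.

Lemma dom_measP b f :
  dom_meas b f <-> dom b f /\ measurable_fun [set: state V R] f.
Proof. by case: b. Qed.

Lemma dele_anti b f g : dele b f g -> dele b g f -> f = g.
Proof. by move=> fg gf; apply/funext => s; exact: dle_anti (fg s) (gf s). Qed.

Lemma fix_of_unique b D Phi Y : is_fix b D Phi Y -> fix_of b D Phi = Y.
Proof.
move=> YF; apply: xget_unique => // Z ZF.
by case: YF ZF => [DY FY lY] [DZ FZ lZ]; apply: (@dele_anti b); auto.
Qed.

(** The meet [Y], in the selected order, of all prefixed points in the carrier is a fixed point. The
    second clause keeps the comparison with prefixed points, which is the form used for loops. *)
Lemma knaster_tarski b (Phi : Expectation V R -> Expectation V R) :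
  (forall f, dom b f -> dom b (Phi f)) ->
  (forall f g, dom b f -> dom b g -> dele b f g -> dele b (Phi f) (Phi g)) ->
  is_fix b (dom b) Phi (fix_of b (dom b) Phi) /\
  forall Z, dom b Z -> dele b (Phi Z) Z -> dele b (fix_of b (dom b) Phi) Z.
Proof.
move=> PhiD Phi_mono.
pose P := [set Z | dom b Z /\ dele b (Phi Z) Z].
pose Y : Expectation V R := fun s =>
  let S := [set Z s | Z in P] in if b then ereal_inf S else ereal_sup S.
have Ylb Z : P Z -> dele b Y Z.
  move=> PZ s; rewrite /Y; case: (b) => /=;
    by [apply: ereal_inf_lbound; exists Z|apply: ereal_sup_ubound; exists Z].
have Yglb f : (forall Z, P Z -> dele b f Z) -> dele b f Y.
  move=> fZ s; rewrite /Y; case: b @P @Y {Ylb PhiD Phi_mono} fZ => /= fZ.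
    by apply: le_ereal_inf_tmp => _ [Z PZ <-]; exact: fZ.
  by apply: ge_ereal_sup => _ [Z PZ <-]; exact: fZ.
(* The greatest element of the selected order is prefixed, and comparing [Y] with it keeps [Y] in
   the carrier. For [b = false] this rules out the supremum of an empty set, which is -oo. *)
have Ptop : P (cst (if b then +oo else 0)).
  have topD : dom b (cst (if b then +oo else 0)).
    apply/domP => s; rewrite /in_dom /dub.
    by case: (b); rewrite /= ?lexx ?lee01 ?leey.
  split => // s; have /domP/(_ s) := PhiD _ topD; rewrite /in_dom.
  by case: (b) => /= /andP[]; rewrite ?leey.
have YD : dom b Y.
  have h1 := Ylb _ Ptop.
  have h2 : dele b (cst (dbot b)) Y.
    by apply: Yglb => Z [/domP ZD _] s; exact: dbot_le.
  apply/domP => s; move: (h1 s) (h2 s); rewrite /in_dom /dub /dbot.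
  by case: (b) => /= -> ->.
have PhiY : dele b (Phi Y) Y.
  apply: Yglb => Z PZ; have [ZD ZP] := PZ => s; apply: dle_trans (ZP s).
  exact: Phi_mono (Ylb _ PZ) s.
(* Tarski's step: by monotonicity [Phi Y] is prefixed as well. *)
have YPhi : dele b Y (Phi Y).
  by apply: Ylb; split; [exact: PhiD|apply: Phi_mono => //; exact: PhiD].
have YF : is_fix b (dom b) Phi Y.
  split => //; first exact: dele_anti PhiY YPhi.
  by move=> Z ZD ZF; apply: Ylb; split => // s; rewrite ZF; exact: dle_refl.
rewrite (fix_of_unique YF); split => // Z ZD ZP; exact: Ylb.
Qed.

End FixedPoints.

(** * Lebesgue sampling: measurability, monotonicity and limits *)

Section UniformSampling.
Context {V : finType} {R : realType}.
Implicit Types (b : bool) (f g : Expectation V R) (x : V) (s : state V R).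
Local Open Scope ereal_scope.
Local Notation mu := (@lebesgue_measure R).

Lemma measurable_sample (D : set R) s x f :
  measurable_fun [set: state V R] f ->
  measurable_fun D (fun xi => f (upd_real s x xi)).
Proof.
move=> mf; apply: (@measurable_funS _ _ _ _ setT) => //.
exact: (measurableT_comp mf (measurable_upd_realr s x)).
Qed.

(** Tonelli's theorem on the product of states and reals. The restriction to [0, 1] becomes an
    indicator factor, so that the inner integral runs over the whole line. *)
Lemma unif_leb_meas x f : (forall s, 0 <= f s) ->
  measurable_fun [set: state V R] f ->
  measurable_fun [set: state V R] (unif_leb x f).
Proof.
move=> f0 mf.
pose F (sr : state V R * R) := f (upd_real sr.1 x sr.2) *
  (\1_(`[0%R, 1%R] : set R) sr.2)%:E.
have mF : measurable_fun [set: (state V R * R)%type] F.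
  apply: emeasurable_funM.
    exact: (measurableT_comp mf (measurable_upd_real x)).
  apply/measurable_EFinP.
  by apply: (measurableT_comp _ measurable_snd); exact: measurable_indic.
have F0 sr : 0 <= F sr by rewrite mule_ge0 // lee_fin.
have := @measurable_fun_fubini_tonelli_F _ _ _ _ R mu F mF F0.
rewrite /fubini_F; congr (measurable_fun _ _).
apply/funext => s; rewrite /unif_leb [RHS]integral_mkcond.
apply: eq_integral => r _; rewrite /F patchE indicE.
by case: ifP => _; rewrite ?mule1 ?mule0.
Qed.

Lemma unif_leb_le x f g : (forall s, 0 <= f s) ->
  measurable_fun [set: state V R] f -> measurable_fun [set: state V R] g ->
  (forall s, f s <= g s) -> forall s, unif_leb x f s <= unif_leb x g s.
Proof.
by move=> f0 mf mg fg s; apply: ge0_le_integral => //; exact: measurable_sample.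
Qed.

Lemma unif_leb_cst x (r : \bar R) s : unif_leb x (cst r) s = r.
Proof.
rewrite /unif_leb integral_cst //= lebesgue_measure_itv /= lte_fin ltr01.
by rewrite -EFinB subr0 mule1.
Qed.

Lemma unif_leb_dom_meas b x f : dom_meas b f -> dom_meas b (unif_leb x f).
Proof.
move=> /dom_measP[/domP fD mf].
have f0 s : 0 <= f s by case/andP: (fD s).
apply/dom_measP; split; last exact: unif_leb_meas.
apply/domP => s; apply/andP; split; first exact: integral_ge0.
rewrite -(unif_leb_cst x (dub b) s).
by apply: unif_leb_le => // t; case/andP: (fD t).
Qed.

Lemma unif_leb_dele b x f g : dom_meas b f -> dom_meas b g ->
  dele b f g -> dele b (unif_leb x f) (unif_leb x g).
Proof.
move=> /dom_measP[/domP fD mf] /dom_measP[/domP gD mg] fg s.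
have f0 t : 0 <= f t by case/andP: (fD t).
have g0 t : 0 <= g t by case/andP: (gD t).
by case: b fg {fD gD} => fg /=; apply: unif_leb_le.
Qed.

Lemma measurable_delim b (u : nat -> Expectation V R) :
  (forall n, measurable_fun [set: state V R] (u n)) ->
  (forall n, dele b (u n) (u n.+1)) ->
  measurable_fun [set: state V R] (delim b u).
Proof.
move=> mu_ uS; apply: (emeasurable_fun_cvg u) => // s _.
by apply: dlim_cvg => n; exact: uS.
Qed.

Lemma delim_dom_meas b (u : nat -> Expectation V R) :
  (forall n, dom_meas b (u n)) -> (forall n, dele b (u n) (u n.+1)) ->
  dom_meas b (delim b u).
Proof.
move=> uD uS; apply/dom_measP; split.
  apply/domP => s; apply: in_dom_dlim => n.
  by have /dom_measP[/domP] := uD n.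
by apply: measurable_delim uS => n; have /dom_measP[] := uD n.
Qed.

(** Increasing sequences are handled by monotone convergence. Decreasing ones take values in [0, 1],
    where the constant 1 is an integrable bound for dominated convergence. *)
Lemma unif_leb_delim b x (u : nat -> Expectation V R) :
  (forall n, dom_meas b (u n)) -> (forall n, dele b (u n) (u n.+1)) ->
  unif_leb x (delim b u) = delim b (fun n => unif_leb x (u n)).
Proof.
move=> uD uS; apply/funext => s; apply/esym.
have mu_ n : measurable_fun [set: state V R] (u n) by have /dom_measP[] := uD n.
have uI n t : in_dom b (u n t) by have /dom_measP[/domP] := uD n.
have u0 n t : 0 <= u n t by case/andP: (uI n t).
have mlim := measurable_delim mu_ uS.
have ucvg t : u n t @[n --> \oo] --> delim b u t.
  by apply: dlim_cvg => n; exact: uS.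
apply: cvg_dlim => [n|]; first exact: unif_leb_dele.
case: b uD uS uI mlim ucvg => uD uS uI mlim ucvg.
  rewrite [X in _ --> X](_ : _ = \int[mu]_(r in `[0%R, 1%R])
      limn (fun n => u n (upd_real s x r))); last first.
    by apply: eq_integral => r _; apply/esym/cvg_lim.
  apply: cvg_monotone_convergence => //.
    by move=> n; exact: measurable_sample.
  move=> r _ n m nm.
  by apply: (@dle_homo _ true (u^~ (upd_real s x r))) nm => k; exact: uS.
have [] := @dominated_convergence _ _ R mu `[0%R, 1%R] (measurable_itv _)
  (fun n r => u n (upd_real s x r)) (fun r => delim false u (upd_real s x r))
  (cst 1).
- by move=> n; exact: measurable_sample.
- exact: measurable_sample.
- by apply: aeW => r _; exact: ucvg.
- apply/integrableP; split; first exact: measurable_cst.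
  rewrite (eq_integral (cst 1)); last by move=> r _; rewrite /= normr1.
  rewrite integral_cst //= lebesgue_measure_itv /= lte_fin ltr01.
  by rewrite -EFinB subr0 mule1 ltry.
- apply: aeW => r n _; rewrite gee0_abs //.
  by have /andP[] := uI n (upd_real s x r).
- by [].
Qed.

End UniformSampling.

(** * Guards and convex combinations *)

Section Rules.
Context {V : finType} {R : realType}.
Implicit Types (b : bool) (f g Y Z : Expectation V R) (s : state V R).
Local Open Scope ereal_scope.

(** As 0 times +oo is 0, guarded sums become case distinctions, to which order and limit arguments
    apply branch by branch. *)
Lemma iverson_mul (c : bool) (x : \bar R) :
  iverson c * x = if c then x else 0.
Proof. by case: c; rewrite /iverson ?mul1e ?mul0e. Qed.

Lemma iverson_if (c : bool) (x y : \bar R) :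
  iverson c * x + iverson (~~ c) * y = if c then x else y.
Proof. by rewrite !iverson_mul; case: c; rewrite ?adde0 ?add0e. Qed.

Lemma iverson_ifN (c : bool) (x y : \bar R) :
  iverson (~~ c) * x + iverson c * y = if c then y else x.
Proof. by rewrite !iverson_mul; case: c; rewrite ?adde0 ?add0e. Qed.

Lemma ratr_itv01 (p : rat) : (0 <= p <= 1)%R ->
  (0 <= ratr p :> R)%R /\ (0 <= 1 - ratr p :> R)%R.
Proof.
move=> /andP[p0 p1]; rewrite subr_ge0 ler0q; split => //.
by rewrite -(rmorph1 (@ratr R)) ler_rat.
Qed.

Lemma in_dom_convex b (p : rat) (x y : \bar R) : (0 <= p <= 1)%R ->
  in_dom b x -> in_dom b y ->
  in_dom b ((ratr p : R)%:E * x + (1 - ratr p : R)%:E * y).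
Proof.
move=> /ratr_itv01[p0 q0] /andP[x0 x1] /andP[y0 y1]; apply/andP; split.
  by rewrite adde_ge0 // mule_ge0.
case: b x1 y1; rewrite /dub ?leey // => x1 y1.
rewrite [leRHS](_ : _ = (ratr p : R)%:E * 1 + (1 - ratr p : R)%:E * 1).
  by apply: leeD; apply: lee_wpmul2l.
by rewrite !mule1 -EFinD addrC subrK.
Qed.

Lemma dle_convex b (p : rat) (x x' y y' : \bar R) : (0 <= p <= 1)%R ->
  dle b x x' -> dle b y y' ->
  dle b ((ratr p : R)%:E * x + (1 - ratr p : R)%:E * y)
        ((ratr p : R)%:E * x' + (1 - ratr p : R)%:E * y').
Proof.
by move=> /ratr_itv01[p0 q0]; case: b => /= hx hy; apply: leeD;
  apply: lee_wpmul2l.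
Qed.

Lemma dlim_convex b (p : rat) (u v : nat -> \bar R) : (0 <= p <= 1)%R ->
  (forall n, in_dom b (u n)) -> (forall n, in_dom b (v n)) ->
  (forall n, dle b (u n) (u n.+1)) -> (forall n, dle b (v n) (v n.+1)) ->
  dlim b (fun n => (ratr p : R)%:E * u n + (1 - ratr p : R)%:E * v n) =
  (ratr p : R)%:E * dlim b u + (1 - ratr p : R)%:E * dlim b v.
Proof.
move=> p01 uD vD uS vS; have [p0 q0] := ratr_itv01 p01.
apply: cvg_dlim => [n|]; first exact: dle_convex.
(* Nonnegativity of the two limits excludes a sum of +oo and -oo, so that addition is continuous
   there. *)
have /andP[lu0 _] := in_dom_dlim uD.
have /andP[lv0 _] := in_dom_dlim vD.
apply: cvgeD.
- by apply: ge0_adde_def; rewrite inE mule_ge0.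
- by apply: cvgeZl => //; exact: dlim_cvg.
- by apply: cvgeZl => //; exact: dlim_cvg.
Qed.

Lemma delim_cst b f : delim b (fun=> f) = f.
Proof. by apply/funext => s; exact: dlim_cst. Qed.

Lemma dom_meas_dbot b : dom_meas b (cst (dbot b) : Expectation V R).
Proof.
apply/dom_measP; split; last exact: measurable_cst.
by apply/domP => s; exact: in_dom_dbot.
Qed.

Lemma dom_meas_if b (phi : {mfun state V R >-> bool}) f g :
  dom_meas b f -> dom_meas b g ->
  dom_meas b (fun s => if phi s then f s else g s).
Proof.
move=> /dom_measP[/domP fD mf] /dom_measP[/domP gD mg].
apply/dom_measP; split; last exact: measurable_fun_ifT.
by apply/domP => s; case: (phi s).
Qed.

End Rules.

(** * Continuity along countable chains *)

Section Continuity.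
Context {V : finType} {R : realType}.
Implicit Types (b : bool) (f g Y Z : Expectation V R) (s : state V R).
Implicit Types (u w : nat -> Expectation V R).
Implicit Types (F : Expectation V R -> Expectation V R).
Local Open Scope ereal_scope.

Definition dchain b u : Prop :=
  (forall n, dom_meas b (u n)) /\ (forall n, dele b (u n) (u n.+1)).

(** Only sequences are considered, since measurability passes to their limits. For [b = false] the
    condition is preservation of infima of decreasing sequences. *)
Definition scott_continuous b F : Prop :=
  (forall f, dom_meas b f -> dom_meas b (F f)) /\
  (forall u, dchain b u -> F (delim b u) = delim b (F \o u)).

(** Continuity is applied to the chain [f], [g], [g], ..., whose supremum is [g]. *)
Lemma scott_continuous_dele b F f g : scott_continuous b F ->
  dom_meas b f -> dom_meas b g -> dele b f g -> dele b (F f) (F g).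
Proof.
move=> [_ FC] fD gD fg.
pose u n := if n is 0%N then f else g.
have uC : dchain b u by split => -[|n] //= s; exact: dle_refl.
have ulim : delim b u = g.
  apply/funext => s; rewrite /delim -dlim_shift; last first.
    by case: uC => _ + n; exact.
  exact: dlim_cst.
by move=> s; rewrite -ulim FC //; exact: (@dlim_ub _ b _ 0%N).
Qed.

Lemma dchain_cst b f : dom_meas b f -> dchain b (fun=> f).
Proof. by move=> fD; split => // n s; exact: dle_refl. Qed.

Lemma dchain_delim b u : dchain b u -> dom_meas b (delim b u).
Proof. by case; exact: delim_dom_meas. Qed.

Lemma dchain_comp b F u : scott_continuous b F -> dchain b u ->
  dchain b (F \o u).
Proof.
move=> FC [uD uS]; split => n /=; first by apply: FC.1.
exact: scott_continuous_dele.
Qed.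

Lemma scott_continuous_comp b F G : scott_continuous b F ->
  scott_continuous b G -> scott_continuous b (F \o G).
Proof.
move=> FC GC; split => [f fD|u uC] /=; first by apply: FC.1; apply: GC.1.
by rewrite GC.2 // FC.2 //; exact: dchain_comp.
Qed.

(** * Loops as limits of Kleene iterates *)

Section Loop.
Variables (b : bool) (phi : {mfun state V R >-> bool}).
Variable F : Expectation V R -> Expectation V R.
Hypothesis FC : scott_continuous b F.

Let Phi f Y : Expectation V R := fun s => if phi s then F Y s else f s.

(** The Kleene iterates, started at the least element of the selected order: 0 for [wp], 1 for
    [wlp]. *)
Let K f n : Expectation V R := iter n (Phi f) (cst (dbot b)).

Let PhiD f Y : dom_meas b f -> dom_meas b Y -> dom_meas b (Phi f Y).
Proof. by move=> fD YD; apply: dom_meas_if => //; apply: FC.1. Qed.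

Let Phi_dele f g Y Z : dom_meas b Y -> dom_meas b Z -> dele b f g ->
  dele b Y Z -> dele b (Phi f Y) (Phi g Z).
Proof.
move=> YD ZD fg YZ s; rewrite /Phi; case: (phi s) => //.
exact: scott_continuous_dele YZ s.
Qed.

Let KD f n : dom_meas b f -> dom_meas b (K f n).
Proof.
by move=> fD; elim: n => [|n IH]; [exact: dom_meas_dbot|exact: PhiD].
Qed.

Let bot_dele f : dom_meas b f -> dele b (cst (dbot b)) f.
Proof. by move=> /dom_measP[/domP fD _] s; exact: dbot_le. Qed.

Let KC f : dom_meas b f -> dchain b (K f).
Proof.
move=> fD; split => n; first exact: KD.
elim: n => [|n IH]; first by apply: bot_dele; exact: KD.
apply: (@Phi_dele f f (K f n) (K f n.+1)) => //; try exact: KD.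
by move=> s; exact: dle_refl.
Qed.

Let Phi_chain u w : dchain b u -> dchain b w ->
  dchain b (fun n => Phi (u n) (w n)).
Proof.
by move=> [uD uS] [wD wS]; split => n; [exact: PhiD|exact: Phi_dele].
Qed.

(** Joint continuity along a common index. A constant [u] yields the fixed point equation, a varying
    [u] the continuity of each Kleene iterate in the post-expectation. *)
Let Phi_delim u w : dchain b u -> dchain b w ->
  Phi (delim b u) (delim b w) = delim b (fun n => Phi (u n) (w n)).
Proof.
move=> uC wC; apply/funext => s; rewrite /Phi FC.2 // /delim.
by case: (phi s).
Qed.

Let W f : Expectation V R := delim b (K f).

Let WD f : dom_meas b f -> dom_meas b (W f).
Proof. by move=> fD; apply: dchain_delim; exact: KC. Qed.

Let W_fix f : dom_meas b f -> is_fix b (dom_meas b) (Phi f) (W f).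
Proof.
move=> fD; split; first exact: WD.
  (* Once [f] is viewed as the limit of a constant chain, the functional merely shifts the Kleene
     sequence by one index, which leaves its supremum unchanged. *)
  rewrite -[in LHS](delim_cst b f) Phi_delim ?delim_cst //; first last.
  - exact: KC.
  - exact: dchain_cst.
  apply/funext => s; apply: (@dlim_shift _ b (fun n => K f n s)) => n.
  by have [_] := KC fD; exact.
move=> Z ZD ZF s; apply: dlim_lub => n; move: s.
elim: n => [|n IH]; first exact: bot_dele.
rewrite -ZF; apply: Phi_dele => //; first exact: KD.
by move=> s; exact: dle_refl.
Qed.

Let K_delim u n : dchain b u ->
  dchain b (fun k => K (u k) n) /\
  K (delim b u) n = delim b (fun k => K (u k) n).
Proof.
move=> uC; elim: n => [|n [IHC IH]] /=.
  by split; [apply: dchain_cst; exact: dom_meas_dbot|rewrite delim_cst].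
by split; [exact: Phi_chain|rewrite IH Phi_delim].
Qed.

Lemma fix_of_loop f : dom_meas b f ->
  fix_of b (dom_meas b) (Phi f) = delim b (K f).
Proof. by move=> fD; apply: fix_of_unique; exact: W_fix. Qed.

Lemma loop_is_fix f : dom_meas b f ->
  is_fix b (dom_meas b) (Phi f) (fix_of b (dom_meas b) (Phi f)).
Proof. by move=> fD; rewrite fix_of_loop //; exact: W_fix. Qed.

Lemma loop_ind f Z : dom_meas b f ->
  (forall Y, dom_meas b Y -> dele b Y Z -> dele b (Phi f Y) Z) ->
  dele b (cst (dbot b)) Z ->
  dele b (fix_of b (dom_meas b) (Phi f)) Z.
Proof.
move=> fD step bZ s; rewrite fix_of_loop //; apply: dlim_lub => n; move: s.
by elim: n => [//|n IH]; apply: step => //; exact: KD.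
Qed.

Lemma scott_continuous_loop :
  scott_continuous b (fun f => fix_of b (dom_meas b) (Phi f)).
Proof.
split => [f fD|u uC]; first by rewrite fix_of_loop //; exact: WD.
have [uD _] := uC.
rewrite fix_of_loop; last exact: dchain_delim.
apply/funext => s; rewrite /delim /=.
under [in RHS]eq_fun do rewrite fix_of_loop //.
(* Exchanging the suprema over the Kleene index and the chain index reduces the claim to continuity
   of the [n]-th iterate. *)
rewrite -dlim_exchange; congr (dlim b _); apply/funext => n.
by have [_ ->] := K_delim n uC.
Qed.

End Loop.

End Continuity.

(** * Comparison of exact and approximate transformers *)

Section Comparison.
Context {V : finType} {R : realType}.
Implicit Types (b : bool) (f g Y Z : Expectation V R) (s : state V R).
Implicit Types (U : V -> Expectation V R -> Expectation V R).
Implicit Types (C : pWhile V R).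
Local Open Scope ereal_scope.

(** By conversion this is [wp] for [b = true] and [wlp] for [b = false]. Likewise
    [approx_transformer] yields the four Riemann transformers when [U] is [unif_lower N] or
    [unif_upper N]. *)
Definition exact_transformer b :
    pWhile V R -> Expectation V R -> Expectation V R :=
  transformer unif_leb (cst (dbot b)) (fix_of b (dom_meas b)).

Definition approx_transformer b U :
    pWhile V R -> Expectation V R -> Expectation V R :=
  transformer U (cst (dbot b)) (fix_of b (dom b)).

Lemma transformer_Observe unif div fp phi f :
  transformer unif div fp (@Observe V R phi) f =
  fun s => if phi s then f s else 0.
Proof. by apply/funext => s /=; rewrite iverson_mul. Qed.

Lemma transformer_Ite unif div fp phi (C1 C2 : pWhile V R) f :
  transformer unif div fp (Ite phi C1 C2) f = fun s =>
    if phi s then transformer unif div fp C1 f s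
    else transformer unif div fp C2 f s.
Proof. by apply/funext => s /=; rewrite iverson_if. Qed.

Lemma transformer_While unif div fp phi (B : pWhile V R) f :
  transformer unif div fp (While phi B) f =
  fp (fun Y s => if phi s then transformer unif div fp B Y s else f s).
Proof.
rewrite /=; congr fp; apply/funext => Y; apply/funext => s.
by rewrite iverson_ifN.
Qed.

Let in_dom0 b : in_dom b (0 : \bar R).
Proof. by rewrite /in_dom lexx; case: b; rewrite /= ?leey ?lee01. Qed.

(** This supplies both the measurability of intermediate post-expectations and the Kleene
    description of exact loops. *)
Lemma exact_scott_continuous b C : scott_continuous b (exact_transformer b C).
Proof.
rewrite /exact_transformer.
elim: C => [||x E|phi|x|phi C1 IH1 C2 IH2|C1 IH1 p p01 C2 IH2
  |C1 IH1 C2 IH2|phi B IH].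
- by split.
- split => [f _|u uC]; first exact: dom_meas_dbot.
  by rewrite /= -[LHS](delim_cst b).
- split => // f /dom_measP[/domP fD mf]; apply/dom_measP; split.
    by apply/domP => s; exact: fD.
  apply: (measurableT_comp mf).
  apply: measurable_upd; first exact: measurable_id.
  exact: (measurableT_comp measurable_num).
- split => [f fD|u [uD uS]]; rewrite transformer_Observe.
    apply: dom_meas_if => //.
    apply/dom_measP; split; last exact: measurable_cst.
    by apply/domP => s; exact: in_dom0.
  apply/funext => s; rewrite /delim /comp /=.
  under [in RHS]eq_fun do rewrite iverson_mul.
  by case: (phi s) => //; rewrite dlim_cst.
- split => [f|u [uD uS]]; first exact: unif_leb_dom_meas.
  exact: unif_leb_delim.
- split => [f fD|u uC].
    by rewrite transformer_Ite; apply: dom_meas_if; [exact: IH1.1|exact: IH2.1].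
  rewrite transformer_Ite IH1.2 // IH2.2 //; apply/funext => s.
  rewrite /delim /comp; under [in RHS]eq_fun do rewrite transformer_Ite.
  by case: (phi s).
- split => [f fD|u uC] /=.
    have /dom_measP[/domP D1 m1] := IH1.1 _ fD.
    have /dom_measP[/domP D2 m2] := IH2.1 _ fD.
    apply/dom_measP; split; first by apply/domP => s; exact: in_dom_convex.
    by apply: emeasurable_funD; apply: measurable_funeM.
  rewrite IH1.2 // IH2.2 //; apply/funext => s; rewrite /delim -dlim_convex //.
  + by move=> n; have [+ _] := dchain_comp IH1 uC => /(_ n)/dom_measP[/domP].
  + by move=> n; have [+ _] := dchain_comp IH2 uC => /(_ n)/dom_measP[/domP].
  + by move=> n; have [_] := dchain_comp IH1 uC; exact.
  + by move=> n; have [_] := dchain_comp IH2 uC; exact.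
- exact: scott_continuous_comp IH1 IH2.
- rewrite (_ : transformer _ _ _ _ = fun f => fix_of b (dom_meas b)
    (fun Y s => if phi s then exact_transformer b B Y s else f s)).
    exact: scott_continuous_loop.
  by apply/funext => f; rewrite transformer_While.
Qed.

(** * Abstract monotone sampling in place of the integral *)

Section Approximation.
Variables (b : bool) (U : V -> Expectation V R -> Expectation V R).
Hypothesis UD : forall x f, dom b f -> dom b (U x f).
Hypothesis U_dele : forall x f g, dom b f -> dom b g ->
  dele b f g -> dele b (U x f) (U x g).

Lemma dom_if (phi : state V R -> bool) f g : dom b f -> dom b g ->
  dom b (fun s => if phi s then f s else g s).
Proof. by move=> /domP fD /domP gD; apply/domP => s; case: (phi s). Qed.

Lemma dele_if (phi : state V R -> bool) f g f' g' :
  dele b f f' -> dele b g g' ->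
  dele b (fun s => if phi s then f s else g s)
         (fun s => if phi s then f' s else g' s).
Proof. by move=> ff' gg' s; case: (phi s). Qed.

Lemma approx_loop (phi : {mfun state V R >-> bool}) F f :
  (forall g, dom b g -> dom b (F g)) ->
  (forall g h, dom b g -> dom b h -> dele b g h -> dele b (F g) (F h)) ->
  dom b f ->
  let Phi := fun Y s => if phi s then F Y s else f s in
  is_fix b (dom b) Phi (fix_of b (dom b) Phi) /\
  forall Z, dom b Z -> dele b (Phi Z) Z -> dele b (fix_of b (dom b) Phi) Z.
Proof.
move=> FD F_dele fD; apply: knaster_tarski => [g gD|g h gD hD gh].
  by apply: dom_if => //; exact: FD.
by apply: dele_if; [exact: F_dele|move=> s; exact: dle_refl].
Qed.

Lemma approx_monotone C :
  (forall f, dom b f -> dom b (approx_transformer b U C f)) /\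
  (forall f g, dom b f -> dom b g -> dele b f g ->
    dele b (approx_transformer b U C f) (approx_transformer b U C g)).
Proof.
rewrite /approx_transformer.
elim: C => [||x E|phi|x|phi C1 [D1 M1] C2 [D2 M2]|C1 [D1 M1] p p01 C2 [D2 M2]
  |C1 [D1 M1] C2 [D2 M2]|phi B [DB MB]].
- by split.
- split => [f _|f g _ _ _ s]; last exact: dle_refl.
  by apply/domP => s; exact: in_dom_dbot.
- split => [f /domP fD|f g _ _ fg s]; last exact: fg.
  by apply/domP => s; exact: fD.
- split => [f fD|f g _ _ fg]; rewrite !transformer_Observe.
    by apply: dom_if => //; apply/domP => s; exact: in_dom0.
  by apply: dele_if => // s; exact: dle_refl.
- by split; [exact: UD|exact: U_dele].
- split => [f fD|f g fD gD fg]; rewrite !transformer_Ite.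
    by apply: dom_if; [exact: D1|exact: D2].
  by apply: dele_if; [exact: M1|exact: M2].
- split => [f fD|f g fD gD fg] /=.
    have /domP h1 := D1 _ fD; have /domP h2 := D2 _ fD.
    by apply/domP => s; exact: in_dom_convex.
  by move=> s; apply: dle_convex => //; [exact: M1|exact: M2].
- by split => [f fD|f g fD gD fg] /=; [exact/D1/D2|apply: M1; auto].
- split => [f fD|f g fD gD fg]; rewrite !transformer_While.
    by have [[]] := approx_loop phi DB MB fD.
  have [_ lfp_f] := approx_loop phi DB MB fD.
  have [[gfD gfE _] _] := approx_loop phi DB MB gD.
  (* The fixed point for [g] is prefixed for the functional of [f], which is pointwise smaller in
     the selected order. *)
  apply: lfp_f => //; rewrite -[X in dele _ _ X]gfE.
  by apply: dele_if => // s; exact: dle_refl.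
Qed.

Lemma approx_dele_exact C f :
  (forall x g, dom_meas b g -> dele b (U x g) (unif_leb x g)) ->
  dom_meas b f ->
  dele b (approx_transformer b U C f) (exact_transformer b C f).
Proof.
move=> Ule; rewrite /approx_transformer /exact_transformer.
have dele_refl g : dele b g g by move=> s; exact: dle_refl.
have [AD AM] := all_and2 approx_monotone.
elim: C f => [||x E|phi|x|phi C1 IH1 C2 IH2|C1 IH1 p p01 C2 IH2
  |C1 IH1 C2 IH2|phi B IH] f fD //.
- exact: Ule.
- by rewrite !transformer_Ite; apply: dele_if; [exact: IH1|exact: IH2].
- by move=> s /=; apply: dle_convex => //; [exact: IH1|exact: IH2].
- have T2 := (exact_scott_continuous b C2).1 _ fD.
  have /dom_measP[T2D _] := T2; have /dom_measP[fD' _] := fD.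
  (* The intermediate term is the approximate [C1] after the exact [C2], since the induction
     hypothesis for [C1] needs a measurable post-expectation. *)
  move=> s /=; apply: dle_trans (IH1 _ T2 s).
  by apply: AM => //; [exact: AD|exact: IH2].
- rewrite !transformer_While; have /dom_measP[fD' _] := fD.
  have [_ least] := approx_loop phi (AD B) (AM B) fD'.
  have [WD WE _] := loop_is_fix phi (exact_scott_continuous b B) fD.
  apply: least; first by have /dom_measP[] := WD.
  (* The exact fixed point is measurable, so the induction hypothesis for [B] applies to it and
     makes it prefixed for the approximate functional. *)
  by rewrite -[X in dele _ _ X]WE; apply: dele_if => //; exact: IH.
Qed.

Lemma exact_dele_approx C f :
  (forall x g, dom_meas b g -> dele b (unif_leb x g) (U x g)) ->
  dom_meas b f ->
  dele b (exact_transformer b C f) (approx_transformer b U C f).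
Proof.
move=> Uge; rewrite /approx_transformer /exact_transformer.
have dele_refl g : dele b g g by move=> s; exact: dle_refl.
have [AD AM] := all_and2 approx_monotone.
elim: C f => [||x E|phi|x|phi C1 IH1 C2 IH2|C1 IH1 p p01 C2 IH2
  |C1 IH1 C2 IH2|phi B IH] f fD //.
- exact: Uge.
- by rewrite !transformer_Ite; apply: dele_if; [exact: IH1|exact: IH2].
- by move=> s /=; apply: dle_convex => //; [exact: IH1|exact: IH2].
- have T2 := (exact_scott_continuous b C2).1 _ fD.
  have /dom_measP[T2D _] := T2; have /dom_measP[fD' _] := fD.
  move=> s /=; apply: dle_trans (IH1 _ T2 s) _.
  by apply: AM => //; [exact: AD|exact: IH2].
- rewrite !transformer_While; have /dom_measP[fD' _] := fD.
  have [[AWD AWE _] _] := approx_loop phi (AD B) (AM B) fD'.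
  (* The approximate fixed point is not known to be measurable, so the induction hypothesis cannot
     be applied to it; the measurable Kleene iterates are compared with it one by one. *)
  apply: (loop_ind (exact_scott_continuous b B)) => // [Y YD Yle|]; last first.
    by move=> s; apply: dbot_le; have /domP := AWD.
  have /dom_measP[YD' _] := YD.
  rewrite -[X in dele _ _ X]AWE; apply: dele_if => // s.
  (* First from exact to approximate at the measurable [Y], then by monotonicity from [Y] up to the
     approximate fixed point. *)
  by apply: dle_trans (IH _ YD s) _; exact: AM.
Qed.

End Approximation.
End Comparison.

(** * Riemann sums against the Lebesgue integral *)

Section RiemannSums.
Context {V : finType} {R : realType}.
Implicit Types (b : bool) (f g : Expectation V R) (x : V) (s : state V R).
Local Open Scope ereal_scope.
Local Notation mu := (@lebesgue_measure R).

Lemma subitv_nonempty N i : Defs.subitv N i (i%:R / N%:R : R)%R.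
Proof. by rewrite /Defs.subitv /= in_itv /= lexx ler_wpM2r // ler_nat. Qed.

Lemma unif_lower_le N x f g : (forall s, f s <= g s) ->
  forall s, unif_lower N x f s <= unif_lower N x g s.
Proof.
move=> fg s; apply: lee_wpmul2l => //; apply: lee_sum => i _.
apply: le_ereal_inf_tmp => _ [xi Ixi <-]; apply: le_trans (fg _).
by apply: ereal_inf_lbound; exists xi.
Qed.

Lemma unif_upper_le N x f g : (forall s, f s <= g s) ->
  forall s, unif_upper N x f s <= unif_upper N x g s.
Proof.
move=> fg s; apply: lee_wpmul2l => //; apply: lee_sum => i _.
apply: ge_ereal_sup => _ [xi Ixi <-]; apply: le_trans (fg _) _.
by apply: ereal_sup_ubound; exists xi.
Qed.

(** The subinterval contains its left end; hence the infimum and supremum of a constant over it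
    return that constant. *)
Lemma image_cst_subitv N i x s (r : \bar R) :
  [set (cst r : Expectation V R) (upd_real s x xi) | xi in Defs.subitv N i] =
  [set r].
Proof.
rewrite predeqE => y; split => [[xi _ <-]//|->].
by exists (i%:R / N%:R)%R => //; exact: subitv_nonempty.
Qed.

Lemma mean_cst N (r : \bar R) : (0 < N)%N -> 0 <= r ->
  (N%:R^-1 : R)%:E * \sum_(i < N) r = r.
Proof.
(* As [r] may be +oo, it is factored out of a sum of ones, using that these are nonnegative. *)
move=> N0 r0; rewrite (eq_bigr (fun=> 1 * r)); last by move=> *; rewrite mul1e.
rewrite -ge0_sume_distrl // sumEFin sumr_const card_ord muleA -EFinM.
by rewrite mulVf ?mul1e // pnatr_eq0 -lt0n.
Qed.

(** Values stay in the domain by comparison with the constants 0 and [dub b], which averaging leaves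
    fixed. *)
Lemma unif_lower_dom b N x f : (0 < N)%N -> dom b f -> dom b (unif_lower N x f).
Proof.
move=> N0 /domP fD.
have cstE (r : \bar R) s : 0 <= r -> unif_lower N x (cst r) s = r.
  move=> r0; rewrite /unif_lower -[RHS](mean_cst N0 r0).
  by under eq_bigr do rewrite image_cst_subitv ereal_inf1.
apply/domP => s; apply/andP; split.
  rewrite -(cstE 0 s) //; apply: unif_lower_le => t; by have /andP[] := fD t.
rewrite -(cstE (dub b) s); last by case: (b); rewrite /= ?leey ?lee01.
by apply: unif_lower_le => t; have /andP[] := fD t.
Qed.

Lemma unif_upper_dom b N x f : (0 < N)%N -> dom b f -> dom b (unif_upper N x f).
Proof.
move=> N0 /domP fD.
have cstE (r : \bar R) s : 0 <= r -> unif_upper N x (cst r) s = r.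
  move=> r0; rewrite /unif_upper -[RHS](mean_cst N0 r0).
  by under eq_bigr do rewrite image_cst_subitv ereal_sup1.
apply/domP => s; apply/andP; split.
  rewrite -(cstE 0 s) //; apply: unif_upper_le => t; by have /andP[] := fD t.
rewrite -(cstE (dub b) s); last by case: (b); rewrite /= ?leey ?lee01.
by apply: unif_upper_le => t; have /andP[] := fD t.
Qed.

(** Half-open pieces are disjoint, and the only point of [0, 1] that they miss, 0, is a null set. *)
Lemma integral_itv01_split (h : R -> \bar R) N : (0 < N)%N ->
  (forall r, 0 <= h r) -> measurable_fun [set: R] h ->
  \int[mu]_(r in `[0%R, 1%R]) h r =
  \sum_(i < N) \int[mu]_(r in `](i%:R / N%:R)%R, (i.+1%:R / N%:R)%R]) h r.
Proof.
move=> N0 h0 mh.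
(* The right end is generalised to k/N for an induction on [k]; the case k = N is the claim. *)
have split_at k : \int[mu]_(r in `[0%R, (k%:R / N%:R)%R]) h r =
    \sum_(i < k) \int[mu]_(r in `](i%:R / N%:R)%R, (i.+1%:R / N%:R)%R]) h r.
  elim: k => [|k IH].
    by rewrite big_ord0 mul0r set_itv1 integral_set1.
  have k1 : (k%:R / N%:R <= k.+1%:R / N%:R :> R)%R.
    by rewrite ler_wpM2r // ler_nat.
  have k0 : (0 <= k%:R / N%:R :> R)%R by [].
  rewrite big_ord_recr -IH /=.
  rewrite (@itv_bndbnd_setU _ _ _ (BRight (k%:R / N%:R)%R)) //.
  rewrite ge0_integral_setU //=.
  - exact: measurable_funS mh.
  - apply/disj_setPS => r [] /=; rewrite !in_itv /= => /andP[_ rk] /andP[kr _].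
    by have := lt_le_trans kr rk; rewrite ltxx.
by rewrite -split_at divff // pnatr_eq0 -lt0n.
Qed.

Lemma integral_subitv_cst N i (r : \bar R) : (0 < N)%N ->
  \int[mu]_(xi in `](i%:R / N%:R)%R, (i.+1%:R / N%:R)%R]) cst r xi =
  (N%:R^-1 : R)%:E * r.
Proof.
move=> N0; rewrite integral_cst //= lebesgue_measure_itv /= lte_fin.
rewrite ltr_pM2r ?invr_gt0 ?ltr0n // ltr_nat ltnSn -EFinB -mulrBl.
by rewrite -natr1 addrC addKr mul1r muleC.
Qed.

(** The mean of the infima is the integral of a step function. Each half-open piece lies in the
    closed piece over which the infimum is taken, so the step function is below the integrand. *)
Lemma unif_lower_leb N x f s : (0 < N)%N -> (forall s, 0 <= f s) ->
  measurable_fun [set: state V R] f ->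
  unif_lower N x f s <= unif_leb x f s.
Proof.
move=> N0 f0 mf; rewrite /unif_leb (integral_itv01_split N0) //; last first.
  exact: measurable_sample.
rewrite /unif_lower ge0_sume_distrr; last first.
  by move=> i _; apply: le_ereal_inf_tmp => _ [xi _ <-].
apply: lee_sum => i _; rewrite -(integral_subitv_cst i) //.
apply: ge0_le_integral => //.
- by move=> r _; apply: le_ereal_inf_tmp => _ [xi _ <-].
- exact: measurable_sample.
- move=> r /= rI; apply: ereal_inf_lbound; exists r => //.
  by move: rI; rewrite /Defs.subitv /= !in_itv /= => /andP[/ltW -> ->].
Qed.

Lemma unif_leb_upper N x f s : (0 < N)%N -> (forall s, 0 <= f s) ->
  measurable_fun [set: state V R] f ->
  unif_leb x f s <= unif_upper N x f s.
Proof.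
move=> N0 f0 mf; rewrite /unif_leb (integral_itv01_split N0) //; last first.
  exact: measurable_sample.
rewrite /unif_upper ge0_sume_distrr; last first.
  (* The supremum is nonnegative because the value at the left end of the subinterval is. *)
  move=> i _; apply: le_trans (f0 (upd_real s x (i%:R / N%:R)%R)) _.
  by apply: ereal_sup_ubound; eexists => //; exact: subitv_nonempty.
apply: lee_sum => i _; rewrite -(integral_subitv_cst i) //.
apply: ge0_le_integral => //.
- exact: measurable_sample.
- move=> r /= rI; apply: ereal_sup_ubound; exists r => //.
  by move: rI; rewrite /Defs.subitv /= !in_itv /= => /andP[/ltW -> ->].
Qed.

End RiemannSums.

(** * The Riemann bounds for both transformers *)

Theorem lemma5p5 (R : realType) (V : finType) (C : pWhile V R)
    (f g : Expectation V R) (N : nat)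
    (hf : EE_meas f) (hg : EE1_meas g) (hN : (1 <= N)%N) :
  (lower_wp N C f ⊑ wp C f /\ wp C f ⊑ upper_wp N C f) /\
  (lower_wlp N C g ⊑ wlp C g /\ wlp C g ⊑ upper_wlp N C g).
Proof.
have lowerD b (x : V) (h : Expectation V R) : dom b h -> dom b (unif_lower N x h).
  exact: unif_lower_dom.
have upperD b (x : V) (h : Expectation V R) : dom b h -> dom b (unif_upper N x h).
  exact: unif_upper_dom.
have lowerM b (x : V) (h k : Expectation V R) : dom b h ->
    dom b k -> dele b h k -> dele b (unif_lower N x h) (unif_lower N x k).
  by move=> _ _; case: b => hk s; exact: unif_lower_le.
have upperM b (x : V) (h k : Expectation V R) : dom b h ->
    dom b k -> dele b h k -> dele b (unif_upper N x h) (unif_upper N x k).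
  by move=> _ _; case: b => hk s; exact: unif_upper_le.
have ge0 b (h : Expectation V R) : dom_meas b h -> forall s, (0 <= h s)%E.
  by move=> /dom_measP[/domP hD _] s; have /andP[] := hD s.
have lower_leb b (x : V) (h : Expectation V R) : dom_meas b h ->
    unif_lower N x h ⊑ unif_leb x h.
  move=> hD s; apply: unif_lower_leb => //; first exact: ge0 hD.
  by have /dom_measP[] := hD.
have leb_upper b (x : V) (h : Expectation V R) : dom_meas b h ->
    unif_leb x h ⊑ unif_upper N x h.
  move=> hD s; apply: unif_leb_upper => //; first exact: ge0 hD.
  by have /dom_measP[] := hD.
split; split.
- exact: (approx_dele_exact (lowerD true) (lowerM true) C (lower_leb true) hf).
- exact: (exact_dele_approx (upperD true) (upperM true) C (leb_upper true) hf).
(* For [wlp] the order is reversed, so the two comparison lemmas trade places: lower sums lie above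
   exact sampling in the selected order. *)
- exact: (exact_dele_approx (lowerD false) (lowerM false) C
    (lower_leb false) hg).
- exact: (approx_dele_exact (upperD false) (upperM false) C
    (leb_upper false) hg).
Qed.
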